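(* Let $A = \begin{pmatrix} a & b \\ c & d \end{pmatrix}$ be a real $2\times 2$ matrix, regarded as the linear map $\mathbf v \mapsto A\mathbf v$ of $\mathbb{R}^2$ into itself. Then there exists a nonzero vector $\mathbf v \in \mathbb{R}^2$ with $\|\mathbf v\| = \|A\mathbf v\|$ (equivalently, a line through the origin all of whose vectors have their Euclidean norm preserved by $A$) if and only if $$a^2 + b^2 + c^2 + d^2 \ge 1 + \det(A)^2 .$$
   Context: $\|\cdot\|$ denotes the usual Euclidean norm on $\mathbb{R}^2$. A norm-preserving line is a line through the origin spanned by a nonzero vector $\mathbf v$ satisfying $\|\mathbf v\| = \|A\mathbf v\|$. *)

(* Defs.v *)
From mathcomp Require Import all_boot all_order all_algebra.
From mathcomp Require Import reals.

Set Implicit Arguments.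
Unset Strict Implicit.
Unset Printing Implicit Defensive.

Import Order.TTheory GRing.Theory Num.Theory.
Local Open Scope ring_scope.

(* The norm that MathComp-Analysis puts on matrices is the sup norm, so the
   Euclidean norm has to be introduced separately. *)
Definition enorm (R : realType) (n : nat) (v : 'cV[R]_n) : R :=
  Num.sqrt (\sum_(i < n) v i 0 ^+ 2).

(* Main.v *)
(* Squaring the norms, A preserves the norm of (x, y) iff (x, y) is a zero of
   the binary quadratic form of A^T A - 1.  Such a form p x^2 + 2 q x y + r y^2
   has a nontrivial real zero iff q^2 - p r >= 0, and here q^2 - p r equals
   a^2 + b^2 + c^2 + d^2 - 1 - det(A)^2. *)
Require Import Defs.
From mathcomp Require Import all_boot all_order all_algebra.
From mathcomp Require Import reals ring lra.

Set Implicit Arguments.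
Unset Strict Implicit.
Unset Printing Implicit Defensive.

Import Order.TTheory GRing.Theory Num.Theory.
Local Open Scope ring_scope.

(** Completing the square: [p] times the form is [(p * x + q * y) ^+ 2 - (q ^+ 2 - p * r) * y ^+ 2],
    and symmetrically with [r]. At a zero, the discriminant times a nonzero square is thus a
    square. *)
Lemma binary_form_isotropic (R : rcfType) (p q r : R) :
  (exists x y : R, (x != 0) || (y != 0) /\
     p * x ^+ 2 + 2 * q * x * y + r * y ^+ 2 = 0) <-> p * r <= q ^+ 2.
Proof.
split=> [[x [y [xy0 form0]]]|disc_ge0].
  have Dy : (q ^+ 2 - p * r) * y ^+ 2 = (p * x + q * y) ^+ 2.
    by apply/eqP; rewrite -subr_eq0 -(mulr0 (- p)) -form0; apply/eqP; ring.
  have Dx : (q ^+ 2 - p * r) * x ^+ 2 = (q * x + r * y) ^+ 2.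
    by apply/eqP; rewrite -subr_eq0 -(mulr0 (- r)) -form0; apply/eqP; ring.
  rewrite -subr_ge0.
  by case/orP: xy0 => [x0|y0];
    [rewrite -(@pmulr_lge0 _ (x ^+ 2)) ?Dx | rewrite -(@pmulr_lge0 _ (y ^+ 2)) ?Dy];
    rewrite ?sqr_ge0 ?exprn_even_gt0.
have [->|p0] := eqVneq p 0.
  by exists 1, 0; rewrite oner_neq0; split=> //; ring.
set s := Num.sqrt (q ^+ 2 - p * r).
have sE : s ^+ 2 = q ^+ 2 - p * r by rewrite sqr_sqrtr // subr_ge0.
(* The root [(s - q) / p] of [p * t ^+ 2 + 2 * q * t + r], in homogeneous coordinates. *)
exists (s - q), p; rewrite p0 orbT; split=> //.
by transitivity (p * (s ^+ 2 - (q ^+ 2 - p * r))); [ring | rewrite sE subrr mulr0].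
Qed.

Lemma enorm_eq (R : realType) (m n : nat) (v : 'cV[R]_m) (w : 'cV[R]_n) :
  enorm v = enorm w <-> \sum_(i < m) v i 0 ^+ 2 = \sum_(i < n) w i 0 ^+ 2.
Proof.
rewrite /enorm; split=> [/eqP|->//].
by rewrite eqr_sqrt ?sumr_ge0 // => [/eqP|i _|i _]; rewrite ?sqr_ge0.
Qed.

(** Carries norm preservation from one vector to the whole line it spans. *)
Lemma enormZ (R : realType) (n : nat) (k : R) (v : 'cV[R]_n) :
  enorm (k *: v) = `|k| * enorm v.
Proof.
rewrite /enorm -sqrtr_sqr -sqrtrM ?sqr_ge0 // mulr_sumr.
by congr Num.sqrt; apply: eq_bigr => i _; rewrite mxE exprMn.
Qed.

Lemma cV2_neq0 (R : nzRingType) (v : 'cV[R]_2) :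
  (v != 0) = (v 0 0 != 0) || (v 1 0 != 0).
Proof.
rewrite -negb_and; congr (~~ _); apply/eqP/andP => [->|[/eqP v0 /eqP v1]].
  by rewrite !mxE.
by apply/colP => i; rewrite mxE; case: (unliftP 0 i) => [j|] ->; rewrite ?ord1 // -v1;
  congr (v _ _); apply: val_inj.
Qed.

Lemma enorm_mulmx2_eq (R : realType) (A : 'M[R]_2) (v : 'cV[R]_2) :
  enorm v = enorm (A *m v) <->
  (A 0 0 ^+ 2 + A 1 0 ^+ 2 - 1) * v 0 0 ^+ 2
  + 2 * (A 0 0 * A 0 1 + A 1 0 * A 1 1) * v 0 0 * v 1 0
  + (A 0 1 ^+ 2 + A 1 1 ^+ 2 - 1) * v 1 0 ^+ 2 = 0.
Proof.
(* [big_ord_recl] writes the second index as a [lift]. *)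
have E1 : lift ord0 ord0 = 1 :> 'I_2 by apply: val_inj.
rewrite enorm_eq !big_ord_recl !big_ord0 !mxE !big_ord_recl !big_ord0 !E1 !addr0.
by split=> ?; lra.
Qed.

Lemma det_mx22 (R : comNzRingType) (A : 'M[R]_2) :
  \det A = A 0 0 * A 1 1 - A 0 1 * A 1 0.
Proof.
have E0 : lift (1 : 'I_2) 0 = 0 by apply: val_inj.
have E1 : lift (0 : 'I_2) 0 = 1 by apply: val_inj.
rewrite (expand_det_row _ 0) !big_ord_recl big_ord0 E1 /cofactor !det_mx11 !mxE.
by rewrite E0 E1 /= addn0 expr0 expr1 mul1r mulN1r mulrN addr0.
Qed.

Lemma exists_enorm_mulmx2_eq (R : realType) (A : 'M[R]_2) :
  (exists v : 'cV[R]_2, v != 0 /\ enorm v = enorm (A *m v)) <->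
  1 + \det A ^+ 2 <= A 0 0 ^+ 2 + A 0 1 ^+ 2 + A 1 0 ^+ 2 + A 1 1 ^+ 2.
Proof.
set p := A 0 0 ^+ 2 + A 1 0 ^+ 2 - 1.
set q := A 0 0 * A 0 1 + A 1 0 * A 1 1.
set r := A 0 1 ^+ 2 + A 1 1 ^+ 2 - 1.
(* Both differences agree by Lagrange's identity for the columns of [A]: [\det A ^+ 2] is the
   product of their squared norms minus [q ^+ 2]. *)
have -> : (1 + \det A ^+ 2 <= A 0 0 ^+ 2 + A 0 1 ^+ 2 + A 1 0 ^+ 2 + A 1 1 ^+ 2)
          = (p * r <= q ^+ 2).
  rewrite -subr_ge0 -[RHS]subr_ge0 det_mx22; congr (0 <= _).
  by rewrite /p /q /r; ring.
rewrite -binary_form_isotropic; split=> [[v [v0 /enorm_mulmx2_eq form0]]|].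
  by exists (v 0 0), (v 1 0); rewrite -cV2_neq0.
case=> x [y [xy0 form0]].
exists (\col_i if i == 0 then x else y).
by rewrite cV2_neq0 enorm_mulmx2_eq !mxE.
Qed.

Theorem theorem1 (R : realType) (A : 'M[R]_2) :
  ((exists v : 'cV[R]_2, v != 0 /\ enorm v = enorm (A *m v)) <->
   A 0 0 ^+ 2 + A 0 1 ^+ 2 + A 1 0 ^+ 2 + A 1 1 ^+ 2 >= 1 + \det A ^+ 2)
  /\
  ((exists v : 'cV[R]_2, v != 0 /\ enorm v = enorm (A *m v)) <->
   (exists L : {vspace 'cV[R]_2}, \dim L = 1%N /\
      forall v : 'cV[R]_2, v \in L -> enorm v = enorm (A *m v))).
Proof.
split; first exact: exists_enorm_mulmx2_eq.
split=> [[v [v0 vA]]|[L [dimL LA]]].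
  exists <[v]>%VS; split; first by rewrite dim_vline v0.
  by move=> _ /vlineP[k ->]; rewrite -scalemxAr !enormZ vA.
(* [vpick L] lies in [L] and vanishes only if [L] is zero, which dimension 1 excludes. *)
exists (vpick L); split; last exact/LA/memv_pick.
by rewrite vpick0 -dimv_eq0 dimL.
Qed.
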